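(* For any integer $s\ge 2$, the semigroup $CAT(\Lambda_s^{\mathbb N})$ is an ID semigroup.
   Context: $\mathbb N$ includes $0$. $\Lambda_s=\{0,1,\dots,s-1\}$ is the symbol set (discrete topology, no algebraic structure), and $\Lambda_s^{\mathbb N}$ is the space of one-sided sequences $a=a_0a_1a_2\dots$ with the product topology. $\sigma$ is the left shift, $\sigma(a)_k=a_{k+1}$. $CAT(\Lambda_s^{\mathbb N})$ is the semigroup (under composition) of all continuous maps $\tau:\Lambda_s^{\mathbb N}\to\Lambda_s^{\mathbb N}$ with $\tau\sigma=\sigma\tau$. A semigroup $\Sigma\subset CAT(\Lambda_s^{\mathbb N})$ is ID if every closed $\Sigma$-invariant proper subset of $\Lambda_s^{\mathbb N}$ is finite; a set $A$ is $\Sigma$-invariant if $\tau(A)\subset A$ for all $\tau\in\Sigma$. *)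

(* Defs.v *)
From HB Require Import structures.
From mathcomp Require Import all_boot.
From mathcomp Require Import boolp classical_sets functions cardinality topology.

Set Implicit Arguments.
Unset Strict Implicit.
Unset Printing Implicit Defensive.

Local Open Scope classical_set_scope.

Definition config (s : nat) : Type :=
  prod_topology (fun _ : nat => discrete_topology 'I_s).

HB.instance Definition _ (s : nat) := Topological.on (config s).

Definition shift_map (s : nat) (a : config s) : config s := fun k => a k.+1.

Definition CAT (s : nat) : set (config s -> config s) :=
  [set tau | continuous tau /\ tau \o @shift_map s = @shift_map s \o tau].
Arguments CAT s : clear implicits.

Definition subsemigroup (T : Type) (Gamma Sigma : set (T -> T)) : Prop :=
  Sigma `<=` Gamma /\
  forall f g, Sigma f -> Sigma g -> Sigma (f \o g).

Definition invariant_set (T : Type) (Sigma : set (T -> T)) (A : set T) : Prop :=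
  forall tau, Sigma tau -> tau @` A `<=` A.

Definition ID_semigroup (s : nat) (Sigma : set (config s -> config s)) : Prop :=
  subsemigroup (CAT s) Sigma /\
  forall A : set (config s),
    closed A -> invariant_set Sigma A -> A `<` setT -> finite_set A.

(* Main.v *)
Require Import Defs.
From mathcomp Require Import all_boot.
From mathcomp Require Import boolp classical_sets functions cardinality.
From mathcomp Require Import topology.

(** Let [A] be closed, invariant and infinite, let [y] be any configuration and
    fix [n]. Only finitely many configurations [a] have a coincidence among
    [a, sigma a, ..., sigma^(n-1) a], since such an [a] is eventually periodic
    with preperiod and period bounded by [n]. So some [a] in [A] has [n] distinct
    first iterates, hence [n] distinct windows of some common length [r] at the
    positions [0, ..., n-1]. The block code sending the [k]-th of these windows
    to [y k] maps [a] to a point of [A] that agrees with [y] on [[0, n[].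
    Closedness of [A] then gives [y \in A]. *)

Set Implicit Arguments.
Unset Strict Implicit.
Unset Printing Implicit Defensive.

Local Open Scope classical_set_scope.

(** The product topology is the supremum of the topologies pulled back along the coordinates, and
    singletons are open in each discrete factor. *)
Lemma config_cvg (s : nat) (F : set_system (config s)) (y : config s)
    {FF : Filter F} :
  F --> y <-> forall k, \forall x \near F, x k = y k.
Proof.
rewrite cvg_sup; split=> [Fy k|Fy k U].
  apply: (Fy k); exists [set x : config s | x k = y k]; split=> //.
  by exists [set y k] => //; exact: discrete_open.
move=> [V [[W _ <-] Wy] WU]; apply: filterS WU _.
by apply: filterS (Fy k) => x xk; move: Wy; rewrite /= /preimage /= xk.
Qed.

Lemma nbhs_coordinate (s : nat) (x : config s) (k : nat) :
  \forall z \near x, z k = x k.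
Proof. by have /config_cvg : nbhs x --> x by []; exact. Qed.

Definition block_code (s r : nat) (f : {ffun 'I_r -> 'I_s} -> 'I_s) :
  config s -> config s :=
  fun x k => f [ffun i : 'I_r => x (k + i)].

(** Each output coordinate depends on only [r] input coordinates, by a rule independent of the
    position: the easy half of the Curtis-Hedlund-Lyndon theorem. *)
Lemma block_code_CAT (s r : nat) (f : {ffun 'I_r -> 'I_s} -> 'I_s) :
  CAT s (block_code f).
Proof.
split=> [x|]; last first.
  apply/funext => x; apply/funext => k /=; rewrite /block_code /shift_map.
  by congr f; apply/ffunP => i; rewrite !ffunE addSn.
have Fx : Filter (nbhs x) by exact: nbhs_filter.
apply/config_cvg => k.
have := filter_forall Fx (fun i : 'I_r => nbhs_coordinate x (k + i)).
apply: filterS => z zx; rewrite /block_code.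
by congr f; apply/ffunP => i; rewrite !ffunE zx.
Qed.

Definition shift_coincidence (s n : nat) : set (config s) :=
  [set a | exists i j, i < j < n /\ forall k, a (i + k) = a (j + k)].

Lemma eventually_periodic_modn (T : Type) (a : nat -> T) (i p k : nat) :
  (forall l, a (i + l) = a (i + p + l)) -> a (i + k) = a (i + k %% p).
Proof.
move=> ap; rewrite {1}(divn_eq k p); elim: (k %/ p) => [//|q IHq].
by rewrite mulSn -addnA addnA -ap.
Qed.

Lemma finite_shift_coincidence (s n : nat) :
  finite_set (@shift_coincidence s n).
Proof.
(* A coincidence at [i < j] makes [a] periodic from [i] on with period [j - i], so [i], [j] and the
   first [n] symbols determine [a]. For [i < j] the folded index stays below [n], so the default of
   [insubd] is never reached. *)
pose decode (t : 'I_n * 'I_n * {ffun 'I_n -> 'I_s}) : config s := fun m =>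
  let: (i, j, v) := t in
  v (insubd i (if m < i then m else i + (m - i) %% (j - i))).
apply: (@sub_finite_set _ _ (decode @` setT)); last first.
  exact/finite_image/finite_finset.
move=> a [i [j [/andP[ij jn] aij]]].
exists (Ordinal (ltn_trans ij jn), Ordinal jn, [ffun l : 'I_n => a l]) => //.
apply/funext => m /=; rewrite ffunE /= val_insubd.
case: (ltnP m i) => [mi|im]; first by rewrite (ltn_trans mi (ltn_trans ij jn)).
have lt_j : i + (m - i) %% (j - i) < j.
  by rewrite -[ltnRHS](subnKC (ltnW ij)) ltn_add2l ltn_mod subn_gt0.
rewrite (ltn_trans lt_j jn) -[in RHS](subnKC im); apply/esym.
by apply: eventually_periodic_modn => l; rewrite (subnKC (ltnW ij)).
Qed.

Lemma distinct_windows (s n : nat) (a : config s) :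
  ~ shift_coincidence n a ->
  exists r, forall i j : 'I_n,
    (forall l : 'I_r, a (i + l) = a (j + l)) -> i = j.
Proof.
move=> ncoin.
have sep (t : 'I_n * 'I_n) : exists k, t.1 < t.2 -> a (t.1 + k) <> a (t.2 + k).
  case: (ltnP t.1 t.2) => [lt12|_]; last by exists 0.
  apply: contrapT => /forallNP nk; apply: ncoin; exists t.1, t.2.
  split=> [|k]; first by rewrite lt12 /=.
  by apply: contrapT => ak; apply: (nk k).
have [d dP] := choice sep.
(* One more than the largest separating offset, so that every window contains all of them. *)
exists (\max_t d t).+1 => i j eq_ij; apply/val_inj => /=.
have lt_d t : d t < (\max_t d t).+1 by rewrite ltnS leq_bigmax.
case: (ltngtP i j) => [lt_ij|lt_ji|//].
  by have := dP (i, j) lt_ij; have := eq_ij (Ordinal (lt_d (i, j))) => /= ->.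
by have := dP (j, i) lt_ji; have := eq_ij (Ordinal (lt_d (j, i))) => /= ->.
Qed.

Lemma CAT_interpolation (s n : nat) (a y : config s) :
  ~ shift_coincidence n a ->
  exists2 tau, CAT s tau & forall k, k < n -> tau a k = y k.
Proof.
move=> /distinct_windows [r windP].
pose window (x : config s) (k : nat) := [ffun l : 'I_r => x (k + l)].
(* Since the windows are distinct, the pick recovers the position. The value [y 0] only serves
   blocks that are none of these windows. *)
exists (block_code (fun w => if [pick k : 'I_n | window a k == w] is Some k
                             then y k else y 0)).
  exact: block_code_CAT.
move=> k kn; rewrite /block_code.
case: pickP => [k' /eqP eq_w|/(_ (Ordinal kn)) /eqP[] //].
suff -> : k' = Ordinal kn by [].
by apply: windP => l; move/ffunP: eq_w => /(_ l); rewrite !ffunE.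
Qed.

Lemma CAT_comp (s : nat) (f g : config s -> config s) :
  CAT s f -> CAT s g -> CAT s (f \o g).
Proof.
move=> [cf fS] [cg gS]; split=> [x|].
  by apply: continuous_comp; [exact: cg|exact: cf].
by rewrite -compA gS compA fS -compA.
Qed.

Lemma closed_approx (s : nat) (A : set (config s)) (y : config s) :
  closed A ->
  (forall n, exists x, A x /\ forall k, k < n -> x k = y k) -> A y.
Proof.
move=> cA /choice[z zP].
apply: (@closed_cvg _ _ \oo _ z A cA).
  by apply: filterE => n; have [] := zP n.
apply/config_cvg => k; exists k.+1 => // n /= kn.
by have [_ ->] := zP n.
Qed.

Theorem theorem3p12 (s : nat) (hs : 2 <= s) : ID_semigroup (CAT s).
Proof.
split; first by split=> // f g; exact: CAT_comp.
move=> A cA invA [_ nTA]; apply: contrapT => infA; apply: nTA => y _.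
apply: closed_approx cA _ => n.
(* Otherwise [A] would lie inside a finite set. *)
have [a Aa nca] : exists2 a, A a & ~ shift_coincidence n a.
  apply: contrapT => noa; apply: infA.
  apply: sub_finite_set (finite_shift_coincidence s n) => a Aa.
  by apply: contrapT => nca; apply: noa; exists a.
have [tau tauC tau_y] := CAT_interpolation y nca.
by exists (tau a); split=> //; apply: (invA _ tauC); exists a.
Qed.
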